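(* Let $R(S,\kappa)$ be a near-integral fusion ring. The formal codegrees of $R(S,\kappa)$ are the set of formal codegrees $f$ of $S$ such that $f\neq\mathrm{FPdim}(S)$, along with $\mathrm{FPdim}(S)+d_+^2$ and $\mathrm{FPdim}(S)+d_-^2$.
   Context: A fusion ring $(R,B)$ is a unital associative ring $R$, free as a $\mathbb{Z}$-module with finite basis $B=\{1_R=b_1,\ldots,b_n\}$, such that $b_ib_j=\sum_k c_{ij}^kb_k$ with $c_{ij}^k\in\mathbb{Z}_{\geq0}$, together with an involution $\ast$ of $\{1,\ldots,n\}$ such that $\sum_ja_jb_j\mapsto\sum_ja_jb_{j^\ast}$ is an antiautomorphism of $R$ and $c_{ij}^1=1$ if $i=j^\ast$ and $0$ otherwise. $\mathrm{FPdim}:R\to\mathbb{C}$ is the ring homomorphism sending each $b_i\in B$ to the maximal real eigenvalue of $[c_{ij}^k]_{j,k}$, and $\mathrm{FPdim}(R):=\sum_{b\in B}\mathrm{FPdim}(b)^2$ (likewise for $S$). $\mathrm{Irr}(R)$ is the set of isomorphism classes of finite-dimensional complex irreducible representations of $R$. For $\varphi\in\mathrm{Irr}(R)$, the formal codegree $f_\varphi$ is the scalar by which the central element $\sum_{b\in B}\mathrm{Tr}(\varphi(b))\,b^\ast\in R\otimes_{\mathbb{Z}}\mathbb{C}$ acts in $\varphi$; the formal codegrees of $R$ are the numbers $f_\varphi$ for $\varphi\in\mathrm{Irr}(R)$. A fusion subring is a fusion ring $(S,C)$ with $C\subseteq B$ and $S\subseteq R$ the $\mathbb{Z}$-span of $C$.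 $(R,B)$ is near-integral if it has a fusion subring $(S,C)$ with $|C|+1=|B|$. Then $\rho$ denotes the unique element of $B\setminus C$, $\kappa:=c_{\rho,\rho}^\rho\in\mathbb{Z}_{\geq0}$, and $R$ is denoted $R(S,\kappa)$; its fusion rules are those of $S$ together with $x\rho=\rho x=\mathrm{FPdim}(x)\rho$ for $x\in C$ and $\rho^2=\kappa\rho+\sum_{x\in C}\mathrm{FPdim}(x)x$. $d_+=\mathrm{FPdim}(\rho)$ and $d_-$ are the positive and negative roots of $x^2-\kappa x-\mathrm{FPdim}(S)=0$.
   Formalization: Read literally the claim fails (Ising ring: S=Z[C_2], where 2=FPdim(S) is still a formal codegree of R), so what is dropped is only the formal codegree of S belonging to the representation FPdim, i.e. one copy of FPdim(S), not every formal codegree equal to FPdim(S). *)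

(* Defs.v *)
From HB Require Import structures.
From mathcomp Require Import all_boot all_order all_algebra.
From mathcomp Require Import complex.
From mathcomp Require Import classical_sets reals.

Set Implicit Arguments.
Unset Strict Implicit.
Unset Printing Implicit Defensive.

Import Order.TTheory GRing.Theory Num.Theory.

Local Open Scope ring_scope.
Local Open Scope complex_scope.

(* The basis B is the family [basis] indexed by the finite type [label]. The map
   [star] sends \sum_j a_j b_j to \sum_j a_j b_{j^*}; it is bijective because
   [dual] is involutive, and additive by [starE], so that [starM] is what is left
   of being an antiautomorphism. *)
Record fusionRing := FusionRing {
  carrier :> pzRingType;
  label : finType;
  basis : label -> carrier;
  basisP : forall x : carrier,
    exists! a : {ffun label -> int}, x = \sum_i basis i *~ a i;
  one_idx : label;
  basis1 : basis one_idx = 1;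
  cst : label -> label -> label -> nat;
  basisM : forall i j, basis i * basis j = \sum_k basis k *+ cst i j k;
  dual : label -> label;
  dualK : involutive dual;
  star : carrier -> carrier;
  starE : forall a : label -> int,
    star (\sum_j basis j *~ a j) = \sum_j basis (dual j) *~ a j;
  starM : forall x y, star (x * y) = star y * star x;
  cst1 : forall i j, cst i j one_idx = (i == dual j) }.

Arguments basis {f}.
Arguments one_idx {f}.
Arguments cst {f}.
Arguments dual {f}.

(* A fusion subring is given by its inclusion; the image of [incl] is the Z-span
   of the basis elements indexed by the image of [incl_idx]. *)
Record fusionSubring (S R : fusionRing) := FusionSubring {
  incl : {rmorphism S -> R};
  incl_idx : label S -> label R;
  incl_idx_inj : injective incl_idx;
  incl_basis : forall i, incl (basis i) = basis (incl_idx i) }.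

Section FrobeniusPerron.
Variables (K : realType) (R : fusionRing).

Definition fusion_mx (i : label R) : 'M[K]_#|label R| :=
  \matrix_(j, k) (cst i (enum_val j) (enum_val k))%:R.

Definition max_eigenvalue n (A : 'M[K]_n) (d : K) : Prop :=
  eigenvalue A d /\ forall a, eigenvalue A a -> a <= d.

(* The default value 0 is never used: a maximal real eigenvalue exists by the
   Perron-Frobenius theorem. *)
Definition FPdim (i : label R) : K :=
  xget 0 [set d | max_eigenvalue (fusion_mx i) d]%classic.

Definition FPdim_ring : K := \sum_i FPdim i ^+ 2.

End FrobeniusPerron.

Arguments FPdim K {R}.

Section Representations.
Variables (K : realType) (R : fusionRing).

Record complexRep := ComplexRep {
  rep_dim : nat;
  rep_map :> {rmorphism R -> 'M[K[i]]_rep_dim} }.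

Definition rep_irr (phi : complexRep) : Prop :=
  (0 < rep_dim phi)%N /\
  forall U : {vspace 'cV[K[i]]_(rep_dim phi)},
    (forall (x : R) u, u \in U -> phi x *m u \in U) -> U = 0%VS \/ U = fullv.

Definition rep_iso (phi psi : complexRep) : Prop :=
  exists (P : 'M[K[i]]_(rep_dim psi, rep_dim phi))
         (Q : 'M[K[i]]_(rep_dim phi, rep_dim psi)),
    [/\ P *m Q = 1%:M, Q *m P = 1%:M &
        forall x : R, P *m phi x = psi x *m P].

(* The one-dimensional representation FPdim. *)
Definition is_FPdim_rep (phi : complexRep) : Prop :=
  rep_dim phi = 1%N /\
  forall i : label R, phi (basis i) = ((FPdim K i)%:C)%:M.

(* The left-hand side is the action of \sum_b Tr(phi(b)) b^* on phi, extended
   C-linearly to the complexification of R. *)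
Definition is_codegree_of (phi : complexRep) (f : K[i]) : Prop :=
  \sum_i \tr (phi (basis i)) *: phi (basis (dual i)) = f%:M.

Definition is_formal_codegree (f : K[i]) : Prop :=
  exists phi, rep_irr phi /\ is_codegree_of phi f.

(* phi lists Irr(R): one representative for each isomorphism class. *)
Definition enumerates_Irr n (phi : 'I_n -> complexRep) : Prop :=
  [/\ forall i, rep_irr (phi i),
      forall i j, rep_iso (phi i) (phi j) -> i = j &
      forall psi, rep_irr psi -> exists i, rep_iso psi (phi i)].

(* s lists the formal codegrees with multiplicity, i.e. it is the family
   (f_phi) for phi in Irr(R), in some order. *)
Definition formal_codegrees (s : seq K[i]) : Prop :=
  exists phi : 'I_(size s) -> complexRep,
    enumerates_Irr phi /\ forall i, is_codegree_of (phi i) s`_i.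

End Representations.

(* Main.v *)
(* Write w_x for the integer with x rho = w_x rho. Cyclic symmetry of the
   coefficient of 1 in a triple product gives x rho = rho x = w_x rho and
   rho^2 = kappa rho + E with E = \sum_x w_x x, and w = FPdim because w is a
   positive character. Since E = rho^2 - kappa rho, one reads off
   x E = E x = w_x E, E^2 = D E and E rho = D rho, where D = FPdim(S). By Schur,
   E acts on an irreducible representation of R or S as 0 or as D. If it acts as
   D, then every x acts by w_x, and in the case of R the element rho satisfies
   (rho - d_+) (rho - d_-) = 0, so the representation is FPdim, respectively one
   of two characters of R. If it acts as 0, then so does rho; hence restriction
   to S and extension by rho |-> 0 match these representations of R with the
   irreducible representations of S other than FPdim, without changing the
   formal codegree. *)
Require Import Defs.
From HB Require Import structures.
From mathcomp Require Import all_boot all_order all_algebra.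
From mathcomp Require Import ring complex.
From mathcomp Require Import boolp classical_sets reals.

Set Implicit Arguments.
Unset Strict Implicit.
Unset Printing Implicit Defensive.

Import Order.TTheory GRing.Theory Num.Theory.

Local Open Scope ring_scope.
Local Open Scope complex_scope.

(** * Coordinates and structure constants of a fusion ring *)

Section FusionRingTheory.
Variable R : fusionRing.
Implicit Types (i j k l : label R) (x y : R).

Definition bcoord x : {ffun label R -> int} := projT1 (cid (basisP x)).

Lemma bcoordE x : x = \sum_i basis i *~ bcoord x i.
Proof. by rewrite /bcoord; case: cid => a []. Qed.

Lemma bcoord_sum (a : label R -> int) i :
  bcoord (\sum_j basis j *~ a j) i = a i.
Proof.
rewrite /bcoord; case: cid => b /= [_ b_uniq].
rewrite (b_uniq (finfun a)) ?ffunE //.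
by apply: eq_bigr => j _; rewrite ffunE.
Qed.

Lemma bcoord_sumn (a : label R -> nat) i :
  bcoord (\sum_j basis j *+ a j) i = a i.
Proof. by rewrite -(bcoord_sum (fun j => Posz (a j))). Qed.

Lemma bcoordD x y i : bcoord (x + y) i = bcoord x i + bcoord y i.
Proof.
rewrite -[RHS](bcoord_sum (fun j => bcoord x j + bcoord y j)).
rewrite {1}[x]bcoordE {1}[y]bcoordE -big_split /=.
by under eq_bigr do rewrite -mulrzDr.
Qed.

Lemma bcoordN x i : bcoord (- x) i = - bcoord x i.
Proof.
rewrite -[RHS](bcoord_sum (fun j => - bcoord x j)) {1}[x]bcoordE -sumrN.
by under eq_bigr do rewrite -mulrNz.
Qed.

Lemma sum_basis_delta j : \sum_i basis i *~ (i == j)%:Z = basis j :> R.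
Proof.
rewrite (bigD1 j) //= eqxx mulr1z big1 ?addr0 // => i /negPf ->.
by rewrite mulr0z.
Qed.

Lemma bcoord_basis j i : bcoord (basis j) i = (i == j).
Proof. by rewrite -{1}(sum_basis_delta j) bcoord_sum. Qed.

Lemma bcoord_basisM i j k : bcoord (basis i * basis j) k = cst i j k.
Proof. by rewrite basisM bcoord_sumn. Qed.

(** Differences yield zero, opposites and sums, hence every integer combination of the basis. *)
Lemma basis_ind (P : R -> Prop) :
    (forall i, P (basis i)) -> (forall x y, P x -> P y -> P (x - y)) ->
  forall x, P x.
Proof.
move=> Pb PB x.
have P0 : P 0 by rewrite -(subrr (basis one_idx)); apply: PB.
have PN y : P y -> P (- y) by move=> Py; rewrite -sub0r; apply: PB.
have PD y z : P y -> P z -> P (y + z).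
  by move=> Py Pz; rewrite -[z]opprK; apply: PB => //; apply: PN.
have PMn y n : P y -> P (y *+ n).
  by move=> Py; elim: n => [|n IHn]; rewrite ?mulr0n // mulrS; apply: PD.
rewrite [x]bcoordE; apply: (big_ind P) => // i _.
by case: (bcoord x i) => n; [|apply: PN]; apply: PMn.
Qed.

Lemma cst1l j k : cst one_idx j k = (k == j).
Proof.
have := bcoord_basisM one_idx j k; rewrite basis1 mul1r bcoord_basis.
by case.
Qed.

(** Associativity of the product, read on the coefficient of [basis m]. *)
Lemma cstA i j k m :
  (\sum_l cst i j l * cst l k m = \sum_l cst j k l * cst i l m)%N.
Proof.
have /(congr1 (fun x : R => bcoord x m)) :=
  mulrA (basis i : R) (basis j) (basis k).
have -> : basis i * basis j * basis k =
    \sum_m basis m *+ (\sum_l cst i j l * cst l k m)%N :> R.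
  rewrite basisM mulr_suml; under [RHS]eq_bigr do rewrite -sumrMnr.
  rewrite exchange_big; apply: eq_bigr => l _ /=.
  rewrite mulrnAl basisM -sumrMnl.
  by apply: eq_bigr => p _; rewrite mulnC mulrnA.
have -> : basis i * (basis j * basis k) =
    \sum_m basis m *+ (\sum_l cst j k l * cst i l m)%N :> R.
  rewrite [basis j * _]basisM mulr_sumr; under [RHS]eq_bigr do rewrite -sumrMnr.
  rewrite exchange_big; apply: eq_bigr => l _ /=.
  rewrite mulrnAr basisM -sumrMnl.
  by apply: eq_bigr => p _; rewrite mulnC mulrnA.
by rewrite !bcoord_sumn; case.
Qed.

(* Both sides are the coefficient of 1 in [basis i * basis j * basis k]. *)
Lemma cst_cyclic i j k : cst i j (dual k) = cst j k (dual i).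
Proof.
have := cstA i j k one_idx.
rewrite (bigD1 (dual k)) //= cst1 eqxx muln1 big1 ?addn0; last first.
  by move=> l /negPf lk; rewrite cst1 lk muln0.
move=> ->; rewrite (bigD1 (dual i)) //= cst1 dualK eqxx muln1 big1 ?addn0 //.
move=> l li; rewrite cst1 -{1}(dualK i) (inj_eq (inv_inj (@dualK R))).
by rewrite eq_sym (negPf li) muln0.
Qed.

Lemma star_basis i : star (basis i : R) = basis (dual i).
Proof.
rewrite -{1}(sum_basis_delta i) starE (bigD1 i) //= eqxx mulr1z.
by rewrite big1 ?addr0 // => j /negPf ->; rewrite mulr0z.
Qed.

(** Apply the antiautomorphism [star] to [basis i * basis j] and compare coefficients. *)
Lemma cst_dual i j k : cst (dual j) (dual i) (dual k) = cst i j k.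
Proof.
have := bcoord_basisM (dual j) (dual i) (dual k).
rewrite -!star_basis -starM basisM.
under eq_bigr do rewrite pmulrn.
rewrite starE (reindex_inj (inv_inj (@dualK R))) /=.
by under eq_bigr do rewrite dualK; rewrite bcoord_sum dualK; case.
Qed.

(** Used below to build characters and extensions by zero. The additive extension of [f] is
    multiplicative because both sides are biadditive. *)
Lemma rmorph_of_basis (A : pzRingType) (f : label R -> A) :
    f one_idx = 1 ->
    (forall i j, f i * f j = \sum_k f k *+ cst i j k) ->
  exists F : {rmorphism R -> A}, forall i, F (basis i) = f i.
Proof.
move=> f1 fM.
pose F x : A := \sum_i f i *~ bcoord x i.
have Fb i : F (basis i) = f i.
  rewrite /F (bigD1 i) //= bcoord_basis eqxx mulr1z big1 ?addr0 //.
  by move=> j /negPf ji; rewrite bcoord_basis ji mulr0z.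
have FB : zmod_morphism F.
  move=> x y; rewrite /F -sumrB; apply: eq_bigr => i _.
  by rewrite bcoordD bcoordN mulrzBr.
pose aF := GRing.isZmodMorphism.Build R A F FB.
pose Fa : {additive R -> A} := HB.pack F aF.
have FaE : F = Fa by [].
have FM : monoid_morphism F.
  split=> [|x y]; first by rewrite -basis1 Fb.
  rewrite [x]bcoordE [y]bcoordE mulr_suml FaE !raddf_sum mulr_suml.
  apply: eq_bigr => i _; rewrite mulr_sumr !raddf_sum mulr_sumr.
  apply: eq_bigr => j _; rewrite mulrzAl mulrzAr !raddfMz /= mulrzAl mulrzAr.
  rewrite basisM !Fb fM FaE raddf_sum; congr (_ *~ _ *~ _).
  by apply: eq_bigr => k _; rewrite raddfMn /= Fb.
pose mF := GRing.isMonoidMorphism.Build R A F FM.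
pose Fm : {rmorphism R -> A} := HB.pack F aF mF.
by exists Fm.
Qed.

End FusionRingTheory.

(** * Frobenius-Perron dimensions from a positive character *)

Section FrobeniusPerronTheory.
Variables (K : realType) (R : fusionRing) (w : label R -> K).
Hypothesis w_gt0 : forall i, 0 < w i.
Hypothesis wM : forall i j, w i * w j = \sum_k (cst i j k)%:R * w k.

(* The character is a positive right eigenvector of the fusion matrix: pairing
   it with the absolute values of a left eigenvector bounds every eigenvalue. *)
Lemma FPdim_pos_char i : FPdim K i = w i.
Proof.
pose A := fusion_mx K i.
pose u : 'cV[K]_#|label R| := \col_j w (enum_val j).
have Au : A *m u = w i *: u.
  apply/matrixP=> j k; rewrite !mxE wM (reindex (@enum_val _ (label R))) /=.
    by apply: eq_bigr => l _; rewrite !mxE.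
  exact: onW_bij (enum_val_bij _).
(* [eigenvalue] is about row vectors, whereas [u] is a column eigenvector: if [A - (w i)%:M] were
   invertible, [u] would vanish. *)
have eigA : eigenvalue A (w i).
  rewrite /eigenvalue /eigenspace kermx_eq0 row_free_unit; apply/negP => Aw.
  have /(congr1 (mulmx (invmx (A - (w i)%:M)))) : (A - (w i)%:M) *m u = 0.
    by rewrite mulmxBl Au mul_scalar_mx subrr.
  rewrite mulKmx // mulmx0 => /matrixP/(_ (enum_rank i) 0).
  by rewrite !mxE enum_rankK => wi; have := w_gt0 i; rewrite wi ltxx.
have maxA a : eigenvalue A a -> a <= w i.
  case/eigenvalueP => v vA v0.
  have [k vk] : exists k, v 0 k != 0 by apply/rV0Pn.
  pose N := \sum_k `|v 0 k| * u k 0.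
  have u_gt0 l : 0 < u l 0 by rewrite mxE.
  have N_gt0 : 0 < N.
    rewrite /N (bigD1 k) //= ltr_pwDl ?mulr_gt0 ?normr_gt0 //.
    by apply: sumr_ge0 => l _; rewrite mulr_ge0 // ltW.
  rewrite -(ler_pM2r N_gt0) (le_trans (ler_wpM2r (ltW N_gt0) (ler_norm a))) //.
  have -> : w i * N = \sum_l (\sum_j `|v 0 j| * A j l) * u l 0.
    under [RHS]eq_bigr do rewrite mulr_suml.
    rewrite exchange_big mulr_sumr /=; apply: eq_bigr => j _.
    have /matrixP/(_ j 0) := Au; rewrite [RHS]mxE [LHS]mxE => Auj.
    by rewrite mulrCA -Auj mulr_sumr; apply: eq_bigr => l _; rewrite mulrA.
  rewrite mulr_sumr; apply: ler_sum => l _; rewrite mulrA ler_pM2r // -normrM.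
  have /matrixP/(_ 0 l) := vA; rewrite [RHS]mxE [LHS]mxE => <-.
  rewrite (le_trans (ler_norm_sum _ _ _)) //; apply: ler_sum => j _.
  by rewrite normrM [`|A _ _|]ger0_norm // mxE.
rewrite /FPdim; case: xgetP => [d -> [eigd maxd]|/(_ (w i)) []]; last by [].
by apply/le_anti; rewrite maxA ?maxd.
Qed.

End FrobeniusPerronTheory.

(** * Complex representations, isomorphisms and one-dimensional characters *)

Section RepresentationTheory.
Variables (K : realType) (R : fusionRing).
Implicit Types (phi psi chi : complexRep K R) (f g : K[i]).
Implicit Type c : label R -> K[i].

(** Scalar matrices of size [rep_dim phi] avoid a cast along [rep_dim phi = 1]. *)
Definition affords phi c : Prop :=
  rep_dim phi = 1%N /\ forall i, phi (basis i) = (c i)%:M.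

Lemma scalar_mx_inj n (a b : K[i]) :
  (0 < n)%N -> a%:M = b%:M :> 'M_n -> a = b.
Proof. by case: n => // n _ /matrixP/(_ 0 0); rewrite !mxE !mulr1n. Qed.

Lemma rep_iso_sym phi psi : rep_iso phi psi -> rep_iso psi phi.
Proof.
case=> P [Q [PQ QP Pphi]]; exists Q, P; split=> // x.
by rewrite -[LHS]mulmx1 -PQ !mulmxA -(mulmxA Q) -Pphi mulmxA QP mul1mx.
Qed.

Lemma rep_iso_trans psi phi chi :
  rep_iso phi psi -> rep_iso psi chi -> rep_iso phi chi.
Proof.
case=> P [Q [PQ QP Pphi]] [P' [Q' [PQ' QP' Ppsi]]].
exists (P' *m P), (Q *m Q'); split=> [||x].
- by rewrite mulmxA -(mulmxA P') PQ mulmx1.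
- by rewrite mulmxA -(mulmxA Q) QP' mulmx1.
- by rewrite -mulmxA Pphi mulmxA Ppsi mulmxA.
Qed.

Lemma rep_iso_basis phi psi P Q :
    P *m Q = 1%:M -> Q *m P = 1%:M ->
    (forall i, P *m phi (basis i) = psi (basis i) *m P) ->
  rep_iso phi psi.
Proof.
move=> PQ QP Pb; exists P, Q; split=> //; apply: basis_ind => // x y Px Py.
by rewrite !rmorphB mulmxBr mulmxBl Px Py.
Qed.

Lemma rep_iso_conj phi psi P Q x :
    P *m Q = 1%:M -> P *m phi x = psi x *m P -> psi x = P *m phi x *m Q.
Proof. by move=> PQ ->; rewrite -mulmxA PQ mulmx1. Qed.

(** Conjugation by [P] preserves traces and fixes scalars. *)
Lemma codegree_iso phi psi f :
  rep_iso phi psi -> is_codegree_of phi f -> is_codegree_of psi f.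
Proof.
case=> P [Q [PQ QP Pphi]]; rewrite /is_codegree_of => phif.
have psiE x := rep_iso_conj PQ (Pphi x).
transitivity (P *m (\sum_i \tr (phi (basis i)) *: phi (basis (dual i))) *m Q).
  rewrite mulmx_sumr mulmx_suml; apply: eq_bigr => i _.
  by rewrite !psiE mxtrace_mulC mulmxA QP mul1mx -scalemxAr -scalemxAl.
by rewrite phif mul_mx_scalar -scalemxAl PQ scalemx1.
Qed.

Lemma codegree_uniq phi f g :
  (0 < rep_dim phi)%N -> is_codegree_of phi f -> is_codegree_of phi g -> f = g.
Proof.
by move=> phi_gt0; rewrite /is_codegree_of => -> /(scalar_mx_inj phi_gt0).
Qed.

(** Stable subspaces pull back along [P] to stable subspaces. *)
Lemma irr_iso phi psi : rep_iso phi psi -> rep_irr phi -> rep_irr psi.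
Proof.
move=> [P [Q [PQ QP Pphi]]] [phi_gt0 phi_irr].
have psiE x := rep_iso_conj PQ (Pphi x).
split=> [|U Ustable].
  rewrite lt0n; apply/eqP => psi0; move: P Q PQ QP {Pphi psiE}.
  rewrite psi0 => P Q _ QP.
  (* By ranks, an identity matrix of positive size cannot factor through dimension zero. *)
  have := mxrank1 K[i] (rep_dim phi); rewrite -QP => rk.
  have := leq_trans (mxrankM_maxr Q P) (rank_leq_row P).
  by rewrite rk leqNgt phi_gt0.
pose f : 'Hom('cV[K[i]]_(rep_dim phi), 'cV[K[i]]_(rep_dim psi)) :=
  linfun (mulmx P).
have fE u : f u = P *m u by rewrite lfunE.
case: (phi_irr (f @^-1: U)%VS) => [x u|V0|V1].
- rewrite -!memv_preim !fE => PuU; rewrite mulmxA Pphi -mulmxA; exact: Ustable.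
- left; apply/eqP; rewrite -subv0; apply/subvP => u uU.
  have : Q *m u \in (f @^-1: U)%VS by rewrite -memv_preim fE mulmxA PQ mul1mx.
  rewrite V0 !memv0 => /eqP Qu0.
  by rewrite -(mul1mx u) -PQ -mulmxA Qu0 mulmx0.
- right; apply/eqP; rewrite eqEsubv subvf; apply/subvP => u _.
  have : Q *m u \in (f @^-1: U)%VS by rewrite V1 memvf.
  by rewrite -memv_preim fE mulmxA PQ mul1mx.
Qed.

(* Schur: the kernel of a commuting matrix is a subrepresentation. *)
Lemma irr_mulmx_eq0 phi (A B : 'M[K[i]]_(rep_dim phi)) :
    rep_irr phi -> (forall i, A *m phi (basis i) = phi (basis i) *m A) ->
    A *m B = 0 -> A = 0 \/ B = 0.
Proof.
move=> [_ phi_irr] Abasis AB0.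
have Aphi x : A *m phi x = phi x *m A.
  move: x; apply: basis_ind => // x y Ax Ay.
  by rewrite !rmorphB mulmxBr mulmxBl Ax Ay.
pose f : 'End('cV[K[i]]_(rep_dim phi)) := linfun (mulmx A).
have fE u : f u = A *m u by rewrite lfunE.
case: (phi_irr (lker f)) => [x u|ker0|kerT].
- by rewrite !memv_ker !fE mulmxA Aphi -mulmxA => /eqP ->; rewrite mulmx0.
- right; apply/matrixP => i j; rewrite mxE.
  have : col j B \in lker f by rewrite memv_ker fE colE mulmxA AB0 mul0mx.
  by rewrite ker0 memv0 => /eqP/matrixP/(_ i 0); rewrite !mxE.
- left; apply/matrixP => i j; rewrite mxE.
  have : delta_mx j 0 \in lker f by rewrite kerT memvf.
  by rewrite memv_ker fE -colE => /eqP/matrixP/(_ i 0); rewrite !mxE.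
Qed.

Lemma scalar_stable n (A : 'M[K[i]]_n) a (U : {vspace 'cV[K[i]]_n}) u :
  A = a%:M -> u \in U -> A *m u \in U.
Proof. by move=> -> uU; rewrite mul_scalar_mx memvZ. Qed.

(** Under a scalar action every line is stable, here that of the all-ones vector, so irreducibility
    forces dimension one. *)
Lemma irr_scalar_affords phi c :
  rep_irr phi -> (forall i, phi (basis i) = (c i)%:M) -> affords phi c.
Proof.
move=> [phi_gt0 phi_irr] phib; split=> //.
pose v : 'cV[K[i]]_(rep_dim phi) := const_mx 1.
have v0 : v != 0.
  apply/negP => /eqP/matrixP/(_ (Ordinal phi_gt0) 0); rewrite !mxE => /eqP.
  by rewrite oner_eq0.
have dimv : \dim <[v]> = 1%N by rewrite dim_vline v0.
case: (phi_irr <[v]>%VS) => [x u uv|vE|vE].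
- move: x; apply: basis_ind => [i|x y xU yU]; last first.
    by rewrite rmorphB mulmxBl memvB.
  exact: scalar_stable (phib i) uv.
- by have := dimv; rewrite vE dimv0.
- by have := dimv; rewrite vE dimvf /dim /= muln1.
Qed.

Lemma affords_irr phi c : affords phi c -> rep_irr phi.
Proof.
case: phi => n F [/= n1 _]; subst n; split=> //= U _.
have : (\dim U <= 1)%N.
  by have := dimvS (subvf U); rewrite dimvf /dim /= muln1.
have [/eqP dimU|dimU dimU1] := posnP (\dim U).
  by left; apply/eqP; rewrite -dimv_eq0.
right; apply/eqP; rewrite -(dimv_leqif_eq (subvf U)) dimvf /dim /= muln1.
by rewrite eqn_leq dimU1 dimU.
Qed.

Lemma affords_iso phi psi c : affords phi c -> affords psi c -> rep_iso phi psi.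
Proof.
case: phi psi => n F [m G] [/= n1 Fb] [/= m1 Gb]; subst n m.
apply: (@rep_iso_basis (ComplexRep F) (ComplexRep G) 1%:M 1%:M) => /= [||i].
- exact: mulmx1.
- exact: mulmx1.
- by rewrite Fb Gb mulmx1 mul1mx.
Qed.

Lemma iso_affords phi psi c : rep_iso phi psi -> affords phi c -> affords psi c.
Proof.
move=> iso aff; have [psi_gt0 psi_irr] := irr_iso iso (affords_irr aff).
apply: irr_scalar_affords => // i.
case: iso => P [Q [PQ QP Pphi]].
rewrite (rep_iso_conj PQ (Pphi _)) aff.2.
by rewrite mul_mx_scalar -scalemxAl PQ scalemx1.
Qed.

Lemma affords_codegree phi c :
  affords phi c -> is_codegree_of phi (\sum_i c i * c (dual i)).
Proof.
case=> phi1 phib; rewrite /is_codegree_of raddf_sum /=.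
apply: eq_bigr => i _; rewrite !phib mxtrace_scalar phi1 mulr1n.
by rewrite scale_scalar_mx.
Qed.

Lemma exists_affords c :
    c one_idx = 1 -> (forall i j, c i * c j = \sum_k (cst i j k)%:R * c k) ->
  exists phi, affords phi c.
Proof.
move=> c1 cM.
have [||F Fb] := @rmorph_of_basis R 'M[K[i]]_1 (fun i => (c i)%:M).
- by rewrite c1.
- move=> i j; rewrite -mulmxE -scalar_mxM cM raddf_sum.
  apply: eq_bigr => k _ /=.
  by rewrite mulr_natl raddfMn.
by exists (ComplexRep F).
Qed.

End RepresentationTheory.

(** * Lists of formal codegrees: independence of the enumeration *)

Lemma map_nth_ord (V : nmodType) (s : seq V) :
  s = [seq s`_i | i : 'I_(size s) <- enum 'I_(size s)].
Proof.
apply: (@eq_from_nth _ 0) => [|k ks]; first by rewrite size_map size_enum_ord.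
by rewrite (nth_map (Ordinal ks)) ?size_enum_ord // nth_enum_ord.
Qed.

Section CodegreeLists.
Variables (K : realType) (R : fusionRing).

(** Frees the enumeration of Irr from the index type ['I_(size s)] and from any order: [s] is [f]
    along some reordering [e] of [enum I]. *)
Lemma formal_codegrees_perm (I : finType) (phi : I -> complexRep K R)
    (f : I -> K[i]) (s : seq K[i]) :
    (forall i, rep_irr (phi i)) ->
    (forall i j, rep_iso (phi i) (phi j) -> i = j) ->
    (forall psi, rep_irr psi -> exists i, rep_iso psi (phi i)) ->
    (forall i, is_codegree_of (phi i) (f i)) ->
    perm_eq s [seq f i | i <- enum I] -> formal_codegrees R s.
Proof.
move=> phi_irr phi_inj phi_surj phi_f sf.
have [e e_enum sE] : exists2 e, perm_eq e (enum I) & s = map f e.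
  have [e0 e0_iota ->] := perm_iotaP 0 sf.
  (* An empty [I] is treated apart because [nth] needs a default element. *)
  case eI : (enum I) => [|i0 r].
    by exists [::] => //; move: e0_iota; rewrite eI /= => /perm_nilP ->.
  rewrite -eI; exists (map (nth i0 (enum I)) e0).
    have := perm_map (nth i0 (enum I)) e0_iota.
    by rewrite size_map map_nth_iota0 // take_size.
  rewrite -map_comp; apply/eq_in_map => k; rewrite (perm_mem e0_iota) mem_iota.
  by rewrite size_map => /andP[_ kI]; rewrite (nth_map i0).
rewrite sE.
have e_uniq : uniq e by rewrite (perm_uniq e_enum) enum_uniq.
have e_mem i : i \in e by rewrite (perm_mem e_enum) mem_enum.
pose g (k : 'I_(size (map f e))) : I :=
  tnth (in_tuple e) (cast_ord (size_map f e) k).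
exists (fun k => phi (g k)); split; first split.
- by move=> k; apply: phi_irr.
- move=> k l /phi_inj; rewrite /g => /(tuple_uniqP (in_tuple e) e_uniq).
  exact: cast_ord_inj.
- move=> psi /phi_surj[i iso].
  have /tnthP[k kE] : i \in in_tuple e by apply: e_mem.
  exists (cast_ord (esym (size_map f e)) k).
  by rewrite /g cast_ordKV -kE.
- move=> k; suff -> : (map f e)`_k = f (g k) by apply: phi_f.
  have k_lt : (k < size e)%N by rewrite -(size_map f e).
  by rewrite /g (tnth_nth (g k)) (nth_map (g k)).
Qed.

(** Isomorphism matches two enumerations of Irr by a bijection [g], and codegrees are isomorphism
    invariants. *)
Lemma formal_codegrees_uniq (s t : seq K[i]) :
  formal_codegrees R s -> formal_codegrees R t -> perm_eq s t.
Proof.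
case=> [phi [[phi_irr phi_inj phi_surj] phi_s]].
case=> [psi [[psi_irr psi_inj psi_surj] psi_t]].
have [g gE] := choice (fun i => psi_surj _ (phi_irr i)).
have g_inj : injective g.
  move=> i j gij; apply: phi_inj; apply: rep_iso_trans (gE i) _.
  by rewrite gij; apply: rep_iso_sym.
have g_surj j : exists i, g i = j.
  have [i iso] := phi_surj _ (psi_irr j); exists i; apply: esym; apply: psi_inj.
  exact: rep_iso_trans iso (gE i).
rewrite [s]map_nth_ord [t]map_nth_ord.
have -> : [seq s`_i | i : 'I_(size s) <- enum 'I_(size s)] =
          [seq t`_i | i : 'I_(size t) <- map g (enum 'I_(size s))].
  rewrite -map_comp; apply: eq_map => i /=.
  apply: (codegree_uniq (psi_irr (g i)).1) (psi_t _).
  exact: codegree_iso (gE i) (phi_s i).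
apply: perm_map; apply: uniq_perm => [||j].
- by rewrite (map_inj_uniq g_inj); apply: enum_uniq.
- exact: enum_uniq.
rewrite mem_enum; have [i <-] := g_surj j.
by rewrite map_f ?mem_enum.
Qed.

End CodegreeLists.

(** * Structure constants and duality in a fusion subring *)

Section FusionSubringTheory.
Variables (R S : fusionRing) (iota : fusionSubring S R).

Lemma incl_idx_one : incl_idx iota one_idx = one_idx.
Proof.
have := incl_basis iota one_idx; rewrite basis1 rmorph1 -(basis1 R).
move/(congr1 (fun x : R => bcoord x one_idx)); rewrite !bcoord_basis eqxx.
by case: eqP.
Qed.

Lemma bcoord_incl x k : bcoord (incl iota x) (incl_idx iota k) = bcoord x k.
Proof.
move: x; apply: basis_ind => [i|x y IHx IHy].
  by rewrite incl_basis !bcoord_basis (inj_eq (@incl_idx_inj _ _ iota)).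
by rewrite rmorphB !bcoordD !bcoordN IHx IHy.
Qed.

Lemma bcoord_incl_notin x i :
  (forall k, incl_idx iota k <> i) -> bcoord (incl iota x) i = 0.
Proof.
move=> i_notin; move: x; apply: basis_ind => [k|x y IHx IHy].
  by rewrite incl_basis bcoord_basis; case: eqP => // /esym/i_notin.
by rewrite rmorphB bcoordD bcoordN IHx IHy subrr.
Qed.

(** Allows identities of [S] to be proved in [R], where rho is available. *)
Lemma incl_inj : injective (incl iota).
Proof.
move=> x y xy; rewrite [x]bcoordE [y]bcoordE; apply: eq_bigr => i _.
by rewrite -!bcoord_incl xy.
Qed.

Lemma cst_incl i j k :
  cst (incl_idx iota i) (incl_idx iota j) (incl_idx iota k) = cst i j k.
Proof.
have := bcoord_basisM (incl_idx iota i) (incl_idx iota j) (incl_idx iota k).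
by rewrite -!incl_basis -rmorphM bcoord_incl bcoord_basisM => -[].
Qed.

Lemma cst_incl_notin i j l : (forall k, incl_idx iota k <> l) ->
  cst (incl_idx iota i) (incl_idx iota j) l = 0%N.
Proof.
move=> l_notin; have := bcoord_basisM (incl_idx iota i) (incl_idx iota j) l.
by rewrite -!incl_basis -rmorphM bcoord_incl_notin // => -[].
Qed.

(** A dual is recognised by the coefficient of 1 in a product, which is the same in [S] and in
    [R]. *)
Lemma dual_incl i : dual (incl_idx iota i) = incl_idx iota (dual i).
Proof.
have := cst_incl (dual i) i one_idx.
by rewrite incl_idx_one !cst1 eqxx; case: eqP.
Qed.

Definition restr (K : realType) (phi : complexRep K R) : complexRep K S :=
  @ComplexRep K S (rep_dim phi) (rep_map phi \o incl iota).

Lemma restr_iso (K : realType) (phi psi : complexRep K R) :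
  rep_iso phi psi -> rep_iso (restr phi) (restr psi).
Proof.
by case=> P [Q [PQ QP Pphi]]; exists P, Q; split=> // x; apply: Pphi.
Qed.

End FusionSubringTheory.

(** * Fusion rules of a near-integral ring *)

Section NearIntegral.
Variables (R S : fusionRing) (iota : fusionSubring S R).
Hypothesis near_integral : (#|label S| + 1 = #|label R|)%N.
Variable rho : label R.
Hypothesis rho_notin : forall x : label S, incl_idx iota x <> rho.

Local Notation inj := (incl_idx iota).
Local Notation kappa := (cst rho rho rho).

(** The image avoids rho and has the right cardinality. *)
Lemma imset_incl_idx : [set inj x | x in [set: label S]] = [set~ rho].
Proof.
apply/eqP; rewrite eqEcard card_imset; last exact: incl_idx_inj.
rewrite cardsC1 cardsT -near_integral addn1 leqnn andbT.
by apply/fintype.subsetP => _ /imsetP[x _ ->]; rewrite !inE; apply/eqP.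
Qed.

Lemma labelP i : i = rho \/ exists x, i = inj x.
Proof.
case: (eqVneq i rho) => [|i_rho]; [by left | right].
have : i \in [set inj x | x in [set: label S]] by rewrite imset_incl_idx !inE.
by case/imsetP=> x _ ->; exists x.
Qed.

Lemma sum_label (V : nmodType) (F : label R -> V) :
  \sum_i F i = F rho + \sum_x F (inj x).
Proof.
rewrite (bigD1 rho) //=; congr (_ + _).
rewrite (eq_bigl [in [set inj x | x in [set: label S]]]); last first.
  by move=> i; rewrite /= imset_incl_idx !inE.
rewrite big_imset /=; last by move=> x y _ _; apply: incl_idx_inj.
by apply: eq_bigl => x; rewrite inE.
Qed.

(** Duality preserves the labels of [S], and rho is the only other one. *)
Lemma dual_rho : dual rho = rho.
Proof.
case: (labelP (dual rho)) => // -[x rhox]; case: (@rho_notin (dual x)).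
by rewrite -dual_incl -rhox dualK.
Qed.

(** The integer w_x; [FPdim_wt] identifies it with FPdim(x). *)
Definition wt (x : label S) : nat := cst (inj x) rho rho.

(** Cyclic symmetry turns this into a coefficient of rho in a product of two basis elements of
    [S]. *)
Lemma cst_incl_rho x y : cst (inj x) rho (inj y) = 0%N.
Proof.
rewrite -[y]dualK -dual_incl -cst_cyclic dual_rho.
exact: cst_incl_notin.
Qed.

Lemma cst_rho_incl x y : cst rho (inj x) (inj y) = 0%N.
Proof.
rewrite -[y]dualK -dual_incl cst_cyclic dual_rho.
exact: cst_incl_notin.
Qed.

Lemma cst_rho_inclE x : cst rho (inj x) rho = wt x.
Proof. by rewrite -{2}dual_rho cst_cyclic dual_rho. Qed.

Lemma wt_dual x : wt (dual x) = wt x.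
Proof.
by rewrite -cst_rho_inclE -dual_incl /wt -(cst_dual (inj x)) dual_rho.
Qed.

Lemma cst_rho_rho x : cst rho rho (inj x) = wt x.
Proof.
by rewrite -{1}(dualK x) -dual_incl cst_cyclic dual_rho cst_rho_inclE wt_dual.
Qed.

Lemma wt_one : wt one_idx = 1%N.
Proof. by rewrite /wt incl_idx_one cst1l eqxx. Qed.

(** Compare the coefficients of rho in (x y) rho and x (y rho). *)
Lemma wtM x y : (wt x * wt y = \sum_z cst x y z * wt z)%N.
Proof.
have := cstA (inj x) (inj y) rho rho.
rewrite !sum_label cst_incl_notin // mul0n add0r [X in _ + X]big1 => [|z _].
  by rewrite addr0 mulnC => <-; apply: eq_bigr => z _; rewrite cst_incl.
by rewrite cst_incl_rho.
Qed.

(** Since 1 occurs in x x*, the product of the weights of x and x* is at least 1. *)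
Lemma wt_gt0 x : (0 < wt x)%N.
Proof.
have : (0 < wt x * wt (dual x))%N.
  by rewrite wtM (bigD1 one_idx) //= cst1 dualK eqxx wt_one.
by rewrite muln_gt0 => /andP[].
Qed.

Lemma FPdim_wt (K : realType) x : FPdim K x = (wt x)%:R.
Proof.
apply: (@FPdim_pos_char K S (fun y => (wt y)%:R)) => [y|y z].
  by rewrite ltr0n wt_gt0.
by rewrite -natrM wtM natr_sum; under eq_bigr do rewrite natrM.
Qed.

(** The elements E and D of the overview. Keeping D in [nat] lets identities such as E^2 = D E be
    stated in the ring itself. *)
Definition sum_wt : S := \sum_x basis x *+ wt x.
Definition dim_wt : nat := (\sum_x wt x ^ 2)%N.
Local Notation E := sum_wt.
Local Notation D := dim_wt.

Lemma FPdim_ring_wt (K : realType) : FPdim_ring K S = D%:R.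
Proof.
by rewrite /FPdim_ring natr_sum; apply: eq_bigr => x _; rewrite FPdim_wt natrX.
Qed.

Lemma dim_wt_gt0 : (0 < D)%N.
Proof. by rewrite /D (bigD1 one_idx) //= wt_one. Qed.

Lemma incl_mul_rho x : basis (inj x) * basis rho = basis rho *+ wt x.
Proof.
rewrite basisM sum_label big1 ?addr0 // => y _.
by rewrite cst_incl_rho mulr0n.
Qed.

Lemma rho_mul_incl x : basis rho * basis (inj x) = basis rho *+ wt x.
Proof.
rewrite basisM sum_label cst_rho_inclE big1 ?addr0 // => y _.
by rewrite cst_rho_incl mulr0n.
Qed.

Lemma rho_mul_rho : basis rho * basis rho = basis rho *+ kappa + incl iota E.
Proof.
rewrite basisM sum_label rmorph_sum; congr (_ + _); apply: eq_bigr => x _.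
by rewrite cst_rho_rho rmorphMn incl_basis.
Qed.

Lemma incl_sum_wt : incl iota E = basis rho * basis rho - basis rho *+ kappa.
Proof. by rewrite rho_mul_rho addrC addKr. Qed.

(** Inside [R], E is rho^2 - kappa rho, and x scales the leftmost rho of each term by w_x. *)
Lemma basis_mul_sum_wt x : basis x * E = E *+ wt x.
Proof.
apply: (@incl_inj _ _ iota); rewrite rmorphM rmorphMn incl_basis incl_sum_wt.
rewrite mulrBr mulrA incl_mul_rho mulrnAl mulrnAr incl_mul_rho mulrnBl.
by rewrite mulrnAC.
Qed.

Lemma sum_wt_mul_basis x : E * basis x = E *+ wt x.
Proof.
apply: (@incl_inj _ _ iota); rewrite rmorphM rmorphMn incl_basis incl_sum_wt.
rewrite mulrBl -mulrA rho_mul_incl mulrnAl mulrnAr rho_mul_incl mulrnBl.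
by rewrite mulrnAC.
Qed.

Lemma sum_wt_sq : E * E = E *+ D.
Proof.
rewrite {1}/E mulr_suml /D -sumrMnr; apply: eq_bigr => x _.
by rewrite mulrnAl basis_mul_sum_wt expnS expn1 mulrnA.
Qed.

Lemma sum_wt_mul_rho : incl iota E * basis rho = basis rho *+ D.
Proof.
rewrite rmorph_sum mulr_suml /D -sumrMnr; apply: eq_bigr => x _.
by rewrite rmorphMn incl_basis mulrnAl incl_mul_rho expnS expn1 mulrnA.
Qed.

(** * Irreducible representations of S and R, and their codegrees *)

Section Representations.
Variable K : realType.
Implicit Types (phi : complexRep K R) (psi : complexRep K S).

(** Schur applied to A (A - d) = 0; the case of interest is the action of E, with d = D. *)
Lemma irr_quasi_idem (T : fusionRing) (phi : complexRep K T) A (d : K[i]) :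
    rep_irr phi -> (forall i, A *m phi (basis i) = phi (basis i) *m A) ->
    A *m A = d *: A -> A = 0 \/ A = d%:M.
Proof.
move=> phi_irr Aphi AA.
have /(irr_mulmx_eq0 phi_irr Aphi)[|/eqP] : A *m (A - d%:M) = 0.
- by rewrite mulmxBr AA mul_mx_scalar subrr.
- by left.
- by rewrite subr_eq0 => /eqP; right.
Qed.

Lemma mulmxn_scale n m (A : 'M[K[i]]_n) : A *+ m = m%:R *: A.
Proof. by rewrite scaler_nat. Qed.

Lemma dim_wt_neq0 : D%:R != 0 :> K[i].
Proof. by rewrite pnatr_eq0 -lt0n dim_wt_gt0. Qed.

(** Cancels D in x E = w_x E when E acts as D. *)
Lemma scalar_of_mul_dim n (A : 'M[K[i]]_n) w :
  A *m (D%:R)%:M = (D%:R)%:M *+ w -> A = (w%:R)%:M.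
Proof.
rewrite mul_mx_scalar mulmxn_scale scale_scalar_mx mulrC -scale_scalar_mx.
by move/(scalerI dim_wt_neq0).
Qed.

Lemma irr_sub_cases psi : rep_irr psi ->
  psi E = 0 \/ affords psi (fun x => (wt x)%:R).
Proof.
move=> psi_irr.
case: (@irr_quasi_idem S psi (psi E) D%:R psi_irr) => [x||psiE|psiE].
- by rewrite mulmxE -!rmorphM basis_mul_sum_wt sum_wt_mul_basis.
- by rewrite mulmxE -rmorphM sum_wt_sq rmorphMn mulmxn_scale.
- by left.
right; apply: irr_scalar_affords => // x; apply: scalar_of_mul_dim.
by rewrite mulmxE -psiE -rmorphM basis_mul_sum_wt rmorphMn.
Qed.

(** Here E acts by the sum of the w_x^2, which is D and nonzero. *)
Lemma affords_wt_neq0 psi :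
  affords psi (fun x => (wt x)%:R) -> psi E <> 0.
Proof.
case=> psi1 psib.
have -> : psi E = (D%:R)%:M.
  rewrite rmorph_sum natr_sum raddf_sum; apply: eq_bigr => x _ /=.
  by rewrite rmorphMn psib mulmxn_scale scale_scalar_mx natrX expr2.
rewrite -(raddf0 (@scalar_mx _ _)) => /scalar_mx_inj.
by rewrite psi1 => /(_ isT)/eqP; apply/negP; apply: dim_wt_neq0.
Qed.

Lemma is_FPdim_repE psi :
  is_FPdim_rep psi <-> affords psi (fun x => (wt x)%:R).
Proof.
split=> -[psi1 psib]; split=> // x; move: (psib x);
  by rewrite FPdim_wt (rmorph_nat (real_complex K)).
Qed.

Lemma irr_not_FPdim psi : rep_irr psi -> (~ is_FPdim_rep psi <-> psi E = 0).
Proof.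
move=> psi_irr; rewrite is_FPdim_repE; split=> [nFP|psiE FP].
  by case: (irr_sub_cases psi_irr).
exact: affords_wt_neq0 FP psiE.
Qed.

Lemma exists_affords_wt : exists psi, affords psi (fun x => (wt x)%:R).
Proof.
apply: exists_affords => [|x y]; first by rewrite wt_one.
by rewrite -natrM wtM natr_sum; under eq_bigr do rewrite natrM.
Qed.

Lemma affords_wt_codegree psi : affords psi (fun x => (wt x)%:R) ->
  is_codegree_of psi (FPdim_ring K S)%:C.
Proof.
move/affords_codegree; congr is_codegree_of.
rewrite FPdim_ring_wt rmorph_nat natr_sum; apply: eq_bigr => x _.
by rewrite wt_dual natrX expr2.
Qed.

(** With rho sent to 0, the relation rho^2 = kappa rho + E requires exactly [psi E = 0]. *)
Lemma extend_by_zero psi : psi E = 0 ->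
  exists phi, rep_iso (restr iota phi) psi /\ phi (basis rho) = 0.
Proof.
move=> psiE.
(* Each fibre of [inj] has at most one element, so the sum inverts [inj] and gives 0 at rho. *)
pose f i := \sum_(x | inj x == i) psi (basis x).
have f_rho : f rho = 0 by rewrite /f big1 // => x /eqP/rho_notin.
have f_incl x : f (inj x) = psi (basis x).
  by rewrite /f (big_pred1 x) // => y; apply: inj_eq; apply: incl_idx_inj.
have [||F Fb] := @rmorph_of_basis R _ f.
- by rewrite -(incl_idx_one iota) f_incl basis1 rmorph1.
- move=> i j; rewrite sum_label f_rho mul0rn add0r.
  case: (labelP i) (labelP j) => [->|[x ->]] [->|[y ->]].
  + rewrite f_rho mul0r -[LHS]psiE rmorph_sum; apply: eq_bigr => x _.
    by rewrite rmorphMn cst_rho_rho f_incl.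
  + by rewrite f_rho mul0r big1 // => z _; rewrite cst_rho_incl.
  + by rewrite f_rho mulr0 big1 // => z _; rewrite cst_incl_rho.
  + rewrite !f_incl -rmorphM basisM rmorph_sum; apply: eq_bigr => z _.
    by rewrite rmorphMn f_incl cst_incl.
exists (ComplexRep F); split; last by rewrite /= Fb.
apply: (@rep_iso_basis K S (restr iota (ComplexRep F)) psi 1%:M 1%:M) => [||x].
- exact: mulmx1.
- exact: mulmx1.
by rewrite mulmx1 mul1mx /= incl_basis Fb f_incl.
Qed.

Section VanishingAtRho.
Variable phi : complexRep K R.
Hypothesis phi_rho : phi (basis rho) = 0.

(** As rho acts by 0, stability under [S] and under [R] coincide. *)
Lemma restr_irr : rep_irr (restr iota phi) <-> rep_irr phi.
Proof.
split=> -[dim_gt0 irr]; split=> // U Ustable; apply: irr => x u uU.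
  exact: (Ustable (incl iota x) u uU).
move: x; apply: basis_ind => [i|x y xU yU]; last first.
  by rewrite rmorphB mulmxBl memvB.
case: (labelP i) => [->|[x ->]]; first by rewrite phi_rho mul0mx mem0v.
by rewrite -incl_basis; apply: (Ustable (basis x)).
Qed.

Lemma restr_codegree f :
  is_codegree_of (restr iota phi) f <-> is_codegree_of phi f.
Proof.
rewrite /is_codegree_of sum_label dual_rho phi_rho scaler0 add0r /=.
by under [in X in _ <-> X]eq_bigr do rewrite dual_incl -!incl_basis.
Qed.

Lemma restr_sum_wt : (restr iota phi) E = 0.
Proof.
by rewrite /= incl_sum_wt rmorphB rmorphMn rmorphM phi_rho mul0r mul0rn subrr.
Qed.

Lemma restr_iso_inj phi' : phi' (basis rho) = 0 ->
  rep_iso (restr iota phi) (restr iota phi') -> rep_iso phi phi'.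
Proof.
move=> phi'_rho [P [Q [PQ QP Prestr]]].
apply: (@rep_iso_basis K R phi phi' P Q PQ QP) => i.
case: (labelP i) => [->|[x ->]]; last by rewrite -incl_basis; apply: Prestr.
by rewrite phi_rho phi'_rho mulmx0 mul0mx.
Qed.

End VanishingAtRho.

(** Off rho the value is w_x, written on labels of [R] so that [inj] need not be inverted. *)
Definition rho_char (d : K) (i : label R) : K[i] :=
  if i == rho then d%:C else (cst i rho rho)%:R.

Lemma rho_char_rho d : rho_char d rho = d%:C.
Proof. by rewrite /rho_char eqxx. Qed.

Lemma rho_char_incl d x : rho_char d (inj x) = (wt x)%:R.
Proof. by rewrite /rho_char; case: eqP => // /rho_notin. Qed.

(** The quadratic equation is the relation rho^2 = kappa rho + E evaluated at the character; the
    other products reduce to [wtM] and x rho = w_x rho. *)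
Lemma exists_affords_rho_char d : d ^+ 2 - kappa%:R * d - FPdim_ring K S = 0 ->
  exists phi, affords phi (rho_char d).
Proof.
rewrite FPdim_ring_wt => /eqP; rewrite subr_eq0 subr_eq => /eqP dE.
apply: exists_affords => [|i j].
  by rewrite -(incl_idx_one iota) rho_char_incl wt_one.
rewrite sum_label rho_char_rho; under eq_bigr do rewrite rho_char_incl.
case: (labelP i) (labelP j) => [->|[x ->]] [->|[y ->]].
- rewrite rho_char_rho -rmorphM -expr2 dE rmorphD rmorphM !rmorph_nat addrC.
  congr (_ + _); rewrite natr_sum; apply: eq_bigr => x _.
  by rewrite cst_rho_rho natrX expr2.
- rewrite rho_char_rho rho_char_incl cst_rho_inclE mulrC big1 ?addr0 // => z _.
  by rewrite cst_rho_incl mul0r.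
- rewrite rho_char_rho rho_char_incl big1 ?addr0 // => z _.
  by rewrite cst_incl_rho mul0r.
- rewrite !rho_char_incl cst_incl_notin // mul0r add0r -natrM wtM natr_sum.
  by apply: eq_bigr => z _; rewrite cst_incl natrM.
Qed.

Lemma affords_rho_char_codegree phi d : affords phi (rho_char d) ->
  is_codegree_of phi (FPdim_ring K S + d ^+ 2)%:C.
Proof.
move/affords_codegree; congr is_codegree_of.
rewrite sum_label dual_rho rho_char_rho rmorphD rmorphXn expr2 addrC.
congr (_ + _); rewrite FPdim_ring_wt rmorph_nat natr_sum.
apply: eq_bigr => x _.
by rewrite dual_incl !rho_char_incl wt_dual natrX expr2.
Qed.

Lemma irr_cases (dp dm : K) phi : dp != dm ->
    dp ^+ 2 - kappa%:R * dp - FPdim_ring K S = 0 ->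
    dm ^+ 2 - kappa%:R * dm - FPdim_ring K S = 0 ->
    rep_irr phi ->
  [\/ phi (basis rho) = 0, affords phi (rho_char dp) |
      affords phi (rho_char dm)].
Proof.
move=> dpm dpE dmE phi_irr.
(* Vieta: subtract the two equations and divide by [dp - dm]; substituting the sum in the first
   equation then gives the product. *)
have sum_dpm : dp + dm = kappa%:R.
  have : (dp - dm) * (dp + dm - kappa%:R) = 0.
    have : dp ^+ 2 - kappa%:R * dp - FPdim_ring K S -
      (dm ^+ 2 - kappa%:R * dm - FPdim_ring K S) = 0 by rewrite dpE dmE subrr.
    by move=> <-; ring.
  by move/eqP; rewrite mulf_eq0 !subr_eq0 (negPf dpm) => /eqP.
have prod_dpm : dp * dm = - D%:R.
  rewrite -(FPdim_ring_wt K); apply/eqP; rewrite -subr_eq0 opprK -oppr_eq0.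
  by rewrite -dpE -sum_dpm; apply/eqP; ring.
have E_rho : incl iota E * basis rho = basis rho * incl iota E.
  by rewrite incl_sum_wt mulrBl mulrBr mulrA mulrnAl mulrnAr.
case: (@irr_quasi_idem R phi (phi (incl iota E)) D%:R phi_irr)
  => [i||phiE|phiE].
- rewrite mulmxE -!rmorphM; case: (labelP i) => [->|[x ->]].
    by rewrite E_rho.
  by rewrite -incl_basis -!rmorphM basis_mul_sum_wt sum_wt_mul_basis.
- by rewrite mulmxE -!rmorphM sum_wt_sq !rmorphMn mulmxn_scale.
(* E acts as 0, so E rho = D rho forces rho to act as 0. *)
- have := congr1 phi sum_wt_mul_rho.
  rewrite rmorphM phiE mul0r rmorphMn mulmxn_scale => /esym/eqP.
  by rewrite scaler_eq0 (negPf dim_wt_neq0) => /eqP; constructor 1.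
have phi_incl x : phi (basis (inj x)) = (wt x)%:R%:M.
  apply: scalar_of_mul_dim; rewrite mulmxE -phiE -incl_basis -!rmorphM.
  by rewrite basis_mul_sum_wt !rmorphMn.
have phi_char d : phi (basis rho) = d%:C%:M -> affords phi (rho_char d).
  move=> phi_rho; apply: irr_scalar_affords => // i.
  case: (labelP i) => [->|[x ->]]; first by rewrite rho_char_rho.
  by rewrite rho_char_incl.
have phi_rho2 : phi (basis rho) *m phi (basis rho) =
    kappa%:R *: phi (basis rho) + D%:R%:M.
  by rewrite mulmxE -rmorphM rho_mul_rho rmorphD phiE rmorphMn mulmxn_scale.
(* Since rho is central, Schur applies to the factors of (rho - d_+) (rho - d_-) = 0. *)
case: (@irr_mulmx_eq0 K R phi (phi (basis rho) - dp%:C%:M)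
        (phi (basis rho) - dm%:C%:M) phi_irr) => [i||/eqP|/eqP].
- rewrite mulmxBl mulmxBr mul_scalar_mx mul_mx_scalar; congr (_ - _).
  rewrite mulmxE -!rmorphM; congr (phi _); case: (labelP i) => [->//|[x ->]].
  by rewrite incl_mul_rho rho_mul_incl.
- have kappaE : kappa%:R = dp%:C + dm%:C :> K[i].
    by rewrite -rmorphD /= sum_dpm rmorph_nat.
  have DE : D%:R = - (dp%:C * dm%:C) :> K[i].
    by rewrite -rmorphM /= prod_dpm rmorphN opprK rmorph_nat.
  rewrite mulmxBl !mulmxBr phi_rho2 mul_mx_scalar !mul_scalar_mx.
  rewrite scale_scalar_mx kappaE DE scalerDl raddfN /=.
  by rewrite [_ - _ - dm%:C *: _]addrAC addrK subrr.
- by rewrite subr_eq0 => /eqP/phi_char; constructor 2.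
- by rewrite subr_eq0 => /eqP/phi_char; constructor 3.
Qed.

End Representations.
End NearIntegral.

(** * The formal codegrees of R, as a set and with multiplicity *)

Theorem corollary3p5 (K : realType) (R S : fusionRing)
  (iota : fusionSubring S R)
  (near_integral : (#|label S| + 1 = #|label R|)%N)
  (rho : label R) (rho_notin : forall x : label S, incl_idx iota x <> rho)
  (kappa : nat) (kappaE : kappa = cst rho rho rho)
  (dp dm : K)
  (dp_gt0 : 0 < dp) (dp_root : dp ^+ 2 - kappa%:R * dp - FPdim_ring K S = 0)
  (dm_lt0 : dm < 0) (dm_root : dm ^+ 2 - kappa%:R * dm - FPdim_ring K S = 0) :
  (forall f : K[i],
     is_formal_codegree R f <->
     [\/ exists psi : complexRep K S,
           [/\ rep_irr psi, ~ is_FPdim_rep psi & is_codegree_of psi f],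
         f = (FPdim_ring K S + dp ^+ 2)%:C |
         f = (FPdim_ring K S + dm ^+ 2)%:C]) /\
  (forall sS : seq K[i], formal_codegrees S sS ->
     (FPdim_ring K S)%:C \in sS /\
     forall sR : seq K[i],
       formal_codegrees R sR <->
       perm_eq sR [:: (FPdim_ring K S + dp ^+ 2)%:C,
                      (FPdim_ring K S + dm ^+ 2)%:C
                    & rem (FPdim_ring K S)%:C sS]).
Proof.
subst kappa.
have dpm : dp != dm by rewrite gt_eqF // (lt_trans dm_lt0).
have R_cases phi :=
  irr_cases near_integral rho_notin (phi := phi) dpm dp_root dm_root.
have char_codegree phi d :=
  affords_rho_char_codegree near_integral rho_notin (phi := phi) (d := d).
have [phip phipP] := exists_affords_rho_char near_integral rho_notin dp_root.
have [phim phimP] := exists_affords_rho_char near_integral rho_notin dm_root.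
split=> [f|sS].
  split=> [[phi [phi_irr phi_f]]|[[psi [psi_irr nFP psi_f]]|->|->]].
  - case: (R_cases phi phi_irr)
      => [phi_rho|/char_codegree phi_d|/char_codegree phi_d].
    + have res_irr := (restr_irr near_integral rho_notin phi_rho).2 phi_irr.
      constructor 1; exists (restr iota phi); split=> //; last first.
        exact/(restr_codegree near_integral rho_notin phi_rho).
      apply/(irr_not_FPdim near_integral rho_notin res_irr).
      exact: restr_sum_wt.
    + by constructor 2; apply: codegree_uniq phi_irr.1 phi_f phi_d.
    + by constructor 3; apply: codegree_uniq phi_irr.1 phi_f phi_d.
  - have psiE := (irr_not_FPdim near_integral rho_notin psi_irr).1 nFP.
    have [phi [iso phi_rho]] := extend_by_zero near_integral rho_notin psiE.
    exists phi; split.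
      apply/(restr_irr near_integral rho_notin phi_rho).
      exact: irr_iso (rep_iso_sym iso) psi_irr.
    apply/(restr_codegree near_integral rho_notin phi_rho).
    exact: codegree_iso (rep_iso_sym iso) psi_f.
  - by exists phip; split; [apply: affords_irr phipP | apply: char_codegree].
  - by exists phim; split; [apply: affords_irr phimP | apply: char_codegree].
case=> psi [[psi_irr psi_inj psi_surj] psi_s].
have [psi0 psi0P] := exists_affords_wt near_integral rho_notin K.
(* [i0] is the position of the representation FPdim in the list for [S]. *)
have [i0 iso0] := psi_surj _ (affords_irr psi0P).
have psii0 := iso_affords iso0 psi0P.
have s_i0 : sS`_i0 = (FPdim_ring K S)%:C.
  apply: codegree_uniq (psi_irr i0).1 (psi_s i0) _.
  exact: affords_wt_codegree psii0.
have DsS : (FPdim_ring K S)%:C \in sS by rewrite -s_i0 mem_nth.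
split=> // sR.
(* Irr(R) is indexed by Irr(S) plus one point: the slot [i0] is reused for d_+, [None] carries d_-,
   and the other slots are extensions by zero. *)
pose spec (o : option 'I_(size sS)) (phi : complexRep K R) : Prop :=
  if o is Some i then
    if i == i0 then affords phi (rho_char rho dp)
    else rep_iso (restr iota phi) (psi i) /\ phi (basis rho) = 0
  else affords phi (rho_char rho dm).
pose cod (o : option 'I_(size sS)) : K[i] :=
  if o is Some i then
    if i == i0 then (FPdim_ring K S + dp ^+ 2)%:C else sS`_i
  else (FPdim_ring K S + dm ^+ 2)%:C.
(* The scalar by which rho acts. Its sign separates the three kinds of representations, leaving
   injectivity to be checked only among extensions by zero. *)
pose r (o : option 'I_(size sS)) : K :=
  if o is Some i then if i == i0 then dp else 0 else dm.
have psiE i : i != i0 -> psi i (sum_wt iota rho) = 0.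
  move=> i_i0.
  case: (irr_sub_cases near_integral rho_notin (psi_irr i)) => // FPi.
  by case/eqP: i_i0; apply: psi_inj; apply: affords_iso FPi psii0.
have spec_ex o : exists phi, spec o phi.
  case: o => [i|] /=; last by exists phim.
  case: eqP => [_|/eqP/psiE psiiE]; first by exists phip.
  exact: extend_by_zero.
have [phi phiP] := choice spec_ex.
have phi_rho o : phi o (basis rho) = ((r o)%:C)%:M.
  case: o (phiP o) => [i|] /=; last by case=> _ ->; rewrite rho_char_rho.
  case: eqP => _; first by case=> _ ->; rewrite rho_char_rho.
  by case=> _ ->; rewrite raddf0.
have phi_irr o : rep_irr (phi o).
  case: o (phiP o) => [i|] /=; last exact: affords_irr.
  case: eqP => _; first exact: affords_irr.
  case=> iso phi0; apply/(restr_irr near_integral rho_notin phi0).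
  exact: irr_iso (rep_iso_sym iso) (psi_irr i).
have phi_cod o : is_codegree_of (phi o) (cod o).
  case: o (phiP o) => [i|] /=; last exact: char_codegree.
  case: eqP => _; first exact: char_codegree.
  case=> iso phi0; apply/(restr_codegree near_integral rho_notin phi0).
  exact: codegree_iso (rep_iso_sym iso) (psi_s i).
have phi_inj o o' : rep_iso (phi o) (phi o') -> o = o'.
  move=> iso.
  have rE : r o = r o'.
    case: (iso) => P [Q [PQ _ Pphi]].
    have := rep_iso_conj PQ (Pphi (basis rho)); rewrite !phi_rho.
    rewrite mul_mx_scalar -scalemxAl PQ scalemx1.
    by move/(scalar_mx_inj (phi_irr o').1) => -[].
  case: o o' iso rE (phiP o) (phiP o') => [i|] [j|] //= iso.
  - case: eqP => [->|_]; case: eqP => [->|_] // rE.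
    + by move: dp_gt0; rewrite rE ltxx.
    + by move: dp_gt0; rewrite -rE ltxx.
    move=> [isoi _] [isoj _]; congr Some; apply: psi_inj.
    apply: rep_iso_trans (rep_iso_sym isoi) _.
    exact: rep_iso_trans (restr_iso iota iso) isoj.
  - by case: eqP => _ rE; move: dm_lt0; rewrite -rE ?ltxx // ltNge ltW.
  - by case: eqP => _ rE; move: dm_lt0; rewrite rE ?ltxx // ltNge ltW.
have phi_surj chi : rep_irr chi -> exists o, rep_iso chi (phi o).
  move=> chi_irr; case: (R_cases chi chi_irr) => [chi_rho|chiP|chiP].
  - have chi_res := (restr_irr near_integral rho_notin chi_rho).2 chi_irr.
    have [i iso] := psi_surj _ chi_res.
    exists (Some i); have := phiP (Some i); rewrite /=.
    (* The slot [i0] is excluded: E acts as 0 on the restriction of [chi], but not on FPdim. *)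
    case: eqP => [ii0|_].
      case: (affords_wt_neq0 (iota := iota) (rho := rho)
               (psi := restr iota chi)).
        by apply: iso_affords (rep_iso_sym iso) _; rewrite ii0.
      exact: restr_sum_wt.
    case=> isoi phi0.
    apply: (restr_iso_inj near_integral rho_notin chi_rho phi0).
    exact: rep_iso_trans iso (rep_iso_sym isoi).
  - exists (Some i0); have := phiP (Some i0); rewrite /= eqxx => phiP0.
    exact: affords_iso chiP phiP0.
  - exists None; exact: affords_iso chiP (phiP None).
have codP : perm_eq [seq cod o | o <- enum {: option 'I_(size sS)}]
    [:: (FPdim_ring K S + dp ^+ 2)%:C, (FPdim_ring K S + dm ^+ 2)%:C
      & rem (FPdim_ring K S)%:C sS].
  have -> : enum {: option 'I_(size sS)} = None :: map some (enum 'I_(size sS)).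
    by rewrite !enumT [in LHS]unlock.
  pose e := rem i0 (enum 'I_(size sS)).
  have enumE : perm_eq (enum 'I_(size sS)) (i0 :: e).
    by apply: perm_to_rem; rewrite mem_enum.
  rewrite /= -map_comp.
  apply: (@perm_trans _ [:: cod None, cod (Some i0)
                          & [seq sS`_i | i : 'I_(size sS) <- e]]).
    rewrite perm_cons (perm_trans (perm_map _ enumE)) //= perm_cons.
    rewrite (_ : map _ e = [seq sS`_i | i : 'I_(size sS) <- e]) //.
    apply/eq_in_map => i; rewrite /e rem_filter ?enum_uniq // mem_filter /=.
    by case/andP=> /negPf ->.
  (* The enumeration starts with [None], hence with d_-, so the two heads are swapped. Other entries
     of [sS] may equal FPdim(S), so [rem] need not delete position [i0]; putting the value back on
     both sides settles this. *)
  rewrite /= eqxx -(perm_catCA [:: _] [:: _]) !perm_cons.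
  rewrite -(perm_cons (FPdim_ring K S)%:C) -{1}s_i0.
  apply: perm_trans (perm_to_rem DsS); rewrite perm_sym {1}[sS]map_nth_ord.
  exact: perm_map enumE.
have sR_of := formal_codegrees_perm phi_irr phi_inj phi_surj phi_cod.
(* The list of the [cod o] is one valid list; any other is a permutation of it by uniqueness. *)
split=> [sRP|sRP].
  apply: perm_trans codP.
  exact: formal_codegrees_uniq sRP (sR_of _ (perm_refl _)).
by apply: sR_of; apply: perm_trans sRP _; rewrite perm_sym.
Qed.
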